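(* Let $\alpha,q\in(-1,1)$, $n\ge 1$, $\mathbf{x}=(x_1,\dots,x_n)\in H_{\mathbb R}^n$ and $\lambda_1,\dots,\lambda_n\in\mathbb R$. Then $$\varphi\big(\mathcal{B}^{\lambda_n}_{\alpha,q}(x_n)\cdots\mathcal{B}^{\lambda_1}_{\alpha,q}(x_1)\big)=\sum_{\pi_f\in\mathcal{P}^B(n)}\alpha^{\mathrm{Narc}(\pi_f)}\,q^{\mathrm{rc}(\pi)+2\,\mathrm{rnarc}(\pi_f)}\,\mathrm{K}^{\mathbf{x}}_{\pi_f}.$$
   Context: **Fock space of type B.** $H_{\mathbb R}$ is a separable real Hilbert space, $H$ its complexification, with inner product $\langle\cdot,\cdot\rangle$ linear in the right and antilinear in the left argument. $x\mapsto\bar x$ is a fixed selfadjoint involution on $H$, i.e. a bounded linear selfadjoint operator on $H$ whose square is the identity. $\mathcal F_{\rm fin}(H)=\bigoplus_{n\ge 0}H^{\otimes n}$ is the algebraic full Fock space (finite sums), $H^{\otimes 0}=\mathbb C\Omega$ with $\|\Omega\|=1$. Let $\Sigma(n)$ be the hyperoctahedral group (bijections $\sigma$ of $\{\pm1,\dots,\pm n\}$ with $\sigma(-k)=-\sigma(k)$), generated by $\pi_0=(1,-1)$ and $\pi_i=(i,i+1)$, $1\le i\le n-1$. It acts on $H^{\otimes n}$ by $\pi_0(x_1\otimes\cdots\otimes x_n)=\overline{x_1}\otimes x_2\otimes\cdots\otimes x_n$ and $\pi_i$ interchanging the $i$-th and $(i+1)$-th tensor factors. For $\sigma$ written as a word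 of minimal length in the generators, $l_1(\sigma)$ is the number of occurrences of $\pi_0$ and $l_2(\sigma)$ the number of occurrences of the $\pi_i$, $1\le i\le n-1$. For $\alpha,q\in(-1,1)$ put $P^{(n)}_{\alpha,q}=\sum_{\sigma\in\Sigma(n)}\alpha^{l_1(\sigma)}q^{l_2(\sigma)}\sigma$ for $n\ge1$, $P^{(0)}_{\alpha,q}=I$ (convention $0^0=1$), and define the inner product $$\langle x_1\otimes\cdots\otimes x_m,\,y_1\otimes\cdots\otimes y_n\rangle_{\alpha,q}=\langle x_1\otimes\cdots\otimes x_m,\,P^{(n)}_{\alpha,q}(y_1\otimes\cdots\otimes y_n)\rangle_{0,0},$$ where $\langle x_1\otimes\cdots\otimes x_m,y_1\otimes\cdots\otimes y_n\rangle_{0,0}=\delta_{m,n}\prod_{i}\langle x_i,y_i\rangle$. The vacuum state is $\varphi(X)=\langle\Omega,X\Omega\rangle_{\alpha,q}$. **Operators.** ($\check x_k$ means the factor is omitted.) For $x\in H$: $b_{\alpha,q}(x)\Omega=0$ and, for $n\ge1$, $$b_{\alpha,q}(x)(x_1\otimes\cdots\otimes x_n)=\sum_{k=1}^n q^{n-k}\langle x,x_k\rangle\,x_1\otimes\cdots\otimes\check x_k\otimes\cdots\otimes x_n+\alpha q^{n-1}\sum_{k=1}^n q^{k-1}\langle x,\bar x_k\rangle\,x_1\otimes\cdots\otimes\check x_k\otimes\cdots\otimes x_n.$$ Its adjoint with respect to $\langle\cdot,\cdot\rangle_{\alpha,q}$ is $b^*_{\alpha,q}(x)(x_1\otimes\cdots\otimes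 x_n)=x_1\otimes\cdots\otimes x_n\otimes x$, $b^*_{\alpha,q}(x)\Omega=x$. For a bounded selfadjoint operator $T$ on $H$, the gauge operator is $p(T)\Omega=0$ and $$p(T)(x_1\otimes\cdots\otimes x_n)=\sum_{k=1}^n q^{n-k}x_1\otimes\cdots\otimes\check x_k\otimes\cdots\otimes x_n\otimes T(x_k)+\alpha q^{n-1}\sum_{k=1}^n q^{k-1}x_1\otimes\cdots\otimes\check x_k\otimes\cdots\otimes x_n\otimes T(\bar x_k).$$ Fix a family $(T_x)_{x\in H_{\mathbb R}}$ of bounded selfadjoint operators on $H$. For $x\in H_{\mathbb R}$, $\lambda\in\mathbb R$, put $\mathcal B^{\lambda}_{\alpha,q}(x)=b_{\alpha,q}(x)+b^*_{\alpha,q}(x)+p(T_x)+\lambda I$ on $\mathcal F_{\rm fin}(H)$. **Type-B partitions.** For a set partition $\pi$ of $[n]=\{1,\dots,n\}$, an arc is a pair $\{i,j\}$, $i<j$, of elements of one block such that $j$ is the smallest element of that block greater than $i$. $\mathcal P^B(n)$ is the set of pairs $\pi_f=(\pi,f)$ with $\pi$ a set partition of $[n]$ and $f$ a coloring assigning a color in $\{\pm1\}$ to each arc and color $1$ to each singleton block. A block $B=\{i_1<\dots<i_m\}$ is written $B_c$ with $c=(c_1,\dots,c_{m-1})$, $c_j$ being the color of the arc $\{i_j,i_{j+1}\}$. **Statistics.** $\mathrm{rc}(\pi)$ is the number of unordered pairs of arcs $\{i,j\},\{i',j'\}$ from distinct blocks with $i<i'<j<j'$ (or with the two arcs interchanged).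 An arc $\{i,j\}$ nests $\{i',j'\}$ if $i<i'<j'<j$. $\mathrm{rnarc}(\pi_f)$ is the number of pairs of arcs $(V,W)$, from distinct blocks, such that $V$ nests $W$ and $f(W)=-1$. $\mathrm{Narc}(\pi_f)$ is the number of arcs of color $-1$. **Cumulants.** For $\pi_f\in\mathcal P^B(n)$ and a block $B_c=\{i_1<\dots<i_m\}_{(c_1,\dots,c_{m-1})}$, let $f_j:H\to H$ be $f_j(x)=x$ if $c_j=1$ and $f_j(x)=\bar x$ if $c_j=-1$. Put $\mathrm K^{\mathbf x}(B_c)=\lambda_{i_1}$ if $m=1$, and $$\mathrm K^{\mathbf x}(B_c)=\langle x_{i_m},\,f_{m-1}T_{x_{i_{m-1}}}\cdots f_3T_{x_{i_3}}f_2T_{x_{i_2}}f_1x_{i_1}\rangle\quad\text{if }m\ge2$$ (so it equals $\langle x_{i_2},f_1x_{i_1}\rangle$ for $m=2$). Finally $\mathrm K^{\mathbf x}_{\pi_f}=\prod_{B_c\in\pi_f}\mathrm K^{\mathbf x}(B_c)$. *)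

(* Defs.v *)
From HB Require Import structures.
From mathcomp Require Import all_boot all_order all_algebra perm.
From mathcomp Require Import generic_quotient ring_quotient sesquilinear.
From mathcomp Require Import boolp classical_sets cardinality reals.
From mathcomp Require Import topology normedtype.
From mathcomp Require Import complex ring.
From mathcomp.multinomials Require Import freeg.

Set Implicit Arguments.
Unset Strict Implicit.
Unset Printing Implicit Defensive.
Import Order.TTheory GRing.Theory Num.Theory.
Local Open Scope ring_scope.
Local Open Scope complex_scope.

Section TensorAlgebra.
Variables (K : fieldType) (V : lmodType K).

Definition multilinear (W : lmodType K) (g : seq V -> W) : Prop :=
  forall s1 s2 a x y,
    g (s1 ++ (a *: x + y) :: s2) = a *: g (s1 ++ x :: s2) + g (s1 ++ y :: s2).

Inductive tensor_null : {freeg (seq V) / K} -> Prop :=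
| tensor_null0 : tensor_null 0
| tensor_nullP c s1 s2 a x y u : tensor_null u ->
    tensor_null (c *: (<< s1 ++ (a *: x + y) :: s2 >>
                       - a *: << s1 ++ x :: s2 >> - << s1 ++ y :: s2 >>) + u).

Lemma tensor_nullD u v : tensor_null u -> tensor_null v -> tensor_null (u + v).
Proof.
by elim=> [|c s1 s2 a x y w _ IH] hv; rewrite ?add0r // -addrA; constructor; apply: IH.
Qed.

Lemma tensor_nullZ a u : tensor_null u -> tensor_null (a *: u).
Proof.
elim=> [|c s1 s2 b x y w _ IH]; first by rewrite scaler0; constructor.
by rewrite scalerDr scalerA; constructor.
Qed.

Definition tensor_relation : {pred {freeg (seq V) / K}} :=
  fun u => `[< tensor_null u >].

Lemma tensor_relation_zmod : zmod_closed tensor_relation.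
Proof.
split; first by apply/asboolP; constructor.
move=> u v /asboolP hu /asboolP hv; apply/asboolP.
by apply: tensor_nullD => //; rewrite -scaleN1r; apply: tensor_nullZ.
Qed.

HB.instance Definition _ := GRing.isZmodClosed.Build _ tensor_relation tensor_relation_zmod.

(* The algebraic full Fock space of V, i.e. the direct sum of the algebraic tensor
   powers of V: the free vector space on the words in V, modulo multilinearity. *)
Definition fock : Type := Quotient.quot tensor_relation.
HB.instance Definition _ := GRing.Zmodule.on fock.

Definition fock_pi (u : {freeg (seq V) / K}) : fock :=
  \pi_(Quotient.quot tensor_relation)%qT u.
Definition fock_repr (u : fock) : {freeg (seq V) / K} :=
  repr (u : Quotient.quot tensor_relation).

Lemma fock_reprK u : fock_pi (fock_repr u) = u.
Proof. exact: reprK. Qed.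

Lemma fock_piP u v : fock_pi u = fock_pi v <-> tensor_null (u - v).
Proof.
split => [h|h].
  apply/asboolP; rewrite -[asbool _]/((u - v) \in tensor_relation).
  by rewrite Quotient.idealrBE; apply/eqP.
by apply/eqP; rewrite -Quotient.idealrBE; apply/asboolP.
Qed.

Lemma fock_piD u v : fock_pi (u + v) = fock_pi u + fock_pi v.
Proof. exact: raddfD. Qed.

Definition fock_scale a (u : fock) : fock := fock_pi (a *: fock_repr u).

Lemma fock_scale_pi a u : fock_scale a (fock_pi u) = fock_pi (a *: u).
Proof.
apply/fock_piP; rewrite -scalerBr; apply: tensor_nullZ.
by apply/fock_piP; rewrite fock_reprK.
Qed.

Lemma fock_scaleA a b (u : fock) : fock_scale a (fock_scale b u) = fock_scale (a * b) u.
Proof. by rewrite -(fock_reprK u) !fock_scale_pi scalerA. Qed.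

Lemma fock_scale1 : left_id 1 fock_scale.
Proof. by move=> u; rewrite -(fock_reprK u) fock_scale_pi scale1r. Qed.

Lemma fock_scaleDr : right_distributive fock_scale +%R.
Proof.
move=> a u v; rewrite -(fock_reprK u) -(fock_reprK v).
by rewrite -fock_piD !fock_scale_pi -fock_piD scalerDr.
Qed.

Lemma fock_scaleDl (u : fock) : {morph fock_scale^~ u : a b / a + b}.
Proof.
by move=> a b; rewrite -(fock_reprK u) !fock_scale_pi -fock_piD scalerDl.
Qed.

HB.instance Definition _ := GRing.Zmodule_isLmodule.Build K fock
  fock_scaleA fock_scale1 fock_scaleDr fock_scaleDl.

Definition tens (s : seq V) : fock := fock_pi << s >>.

Definition vacuum : fock := tens [::].

Lemma fock_piZ a u : fock_pi (a *: u) = a *: fock_pi u.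
Proof. by rewrite -fock_scale_pi. Qed.

Lemma tens_multilinear : multilinear tens.
Proof.
move=> s1 s2 a x y; rewrite -fock_piZ -fock_piD; apply/fock_piP.
rewrite opprD addrA -[_ - _]addr0 -[X in X + 0]scale1r.
by do 2 constructor.
Qed.

Lemma fglift_linear (W : lmodType K) (g : seq V -> W) a u v :
  fglift g (a *: u + v) = a *: fglift g u + fglift g v.
Proof.
pose ga := GRing.isZmodMorphism.Build _ _ (fglift g) (lift_is_additive g).
pose gl : {additive {freeg (seq V) / K} -> W} := HB.pack (fglift g) ga.
rewrite -[fglift g]/(gl : _ -> _) raddfD; congr (_ + _).
rewrite -[X in _ = a *: gl X]freeg_sumE [a *: u]/(fgscale a u) /fgscale.
rewrite !raddf_sum /=; apply: eq_bigr => s _.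
by rewrite !liftU scalerA.
Qed.

Lemma fglift0 (W : lmodType K) (g : seq V -> W) : fglift g 0 = 0.
Proof. by have := fglift_linear g (-1) 0 0; rewrite !scaleN1r !addNr. Qed.

Lemma fgliftB (W : lmodType K) (g : seq V -> W) u v :
  fglift g (u - v) = fglift g u - fglift g v.
Proof. by rewrite addrC -[- v]scaleN1r fglift_linear scaleN1r addrC. Qed.

Lemma fglift_tensor_null (W : lmodType K) (g : seq V -> W) u :
  multilinear g -> tensor_null u -> fglift g u = 0.
Proof.
move=> gM; elim=> [|c s1 s2 a x y w _ IH]; first exact: fglift0.
rewrite fglift_linear IH addr0.
have fZ b u1 : fglift g (b *: u1) = b *: fglift g u1.
  by rewrite -[b *: u1]addr0 fglift_linear fglift0 addr0.
by rewrite !fgliftB fZ !liftU gM !scale1r addrAC addrK subrr scaler0.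
Qed.

Section Extension.
Variables (W : lmodType K) (g : seq V -> W) (gM : multilinear g).

(* The linear extension to the whole space of a formula given on the elementary
   tensors; the formula has to be multilinear in the tensor factors. *)
Definition fock_ext of multilinear g : fock -> W :=
  fun u => fglift g (fock_repr u).

Lemma fock_ext_pi u : fock_ext gM (fock_pi u) = fglift g u.
Proof.
apply/eqP; rewrite -subr_eq0 -fgliftB; apply/eqP/fglift_tensor_null => //.
by apply/fock_piP; rewrite fock_reprK.
Qed.

Lemma fock_ext_linear : linear (fock_ext gM).
Proof.
move=> a u v; rewrite -(fock_reprK u) -(fock_reprK v) -fock_piZ -fock_piD.
by rewrite !fock_ext_pi fglift_linear.
Qed.

HB.instance Definition _ := GRing.isLinear.Build K fock W _ (fock_ext gM)
  fock_ext_linear.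

Lemma fock_ext_tens s : fock_ext gM (tens s) = g s.
Proof. by rewrite fock_ext_pi liftU scale1r. Qed.
End Extension.

Lemma fock_ind (P : fock -> Prop) :
  P 0 -> (forall a s u, P u -> P (a *: tens s + u)) -> forall u, P u.
Proof.
move=> P0 PD u; rewrite -(fock_reprK u) -[fock_repr u]freeg_sumE.
elim: (dom _) => [|s r IH].
  by rewrite big_nil; have -> : fock_pi 0 = 0 by exact: raddf0.
rewrite big_cons fock_piD.
suff -> : << coeff s (fock_repr u) *g s >> = coeff s (fock_repr u) *: << s >> :> {freeg (seq V) / K}.
  by rewrite fock_piZ; apply: PD.
by apply/eqP/freeg_eqP => t; rewrite coeffZ !coeffU mul1r.
Qed.

Section RemoveFactor.
Variable W : lmodType K.
Implicit Types (F : V -> seq V -> W) (g h : seq V -> W).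

Definition rem_at k (s : seq V) := take k s ++ drop k.+1 s.

Lemma multilinearD g h : multilinear g -> multilinear h ->
  multilinear (fun s => g s + h s).
Proof. by move=> gM hM s1 s2 a x y; rewrite gM hM scalerDr addrACA. Qed.

Lemma multilinearZ (c : nat -> K) g : multilinear g ->
  multilinear (fun s => c (size s) *: g s).
Proof.
move=> gM s1 s2 a x y; rewrite gM scalerDr !scalerA mulrC -!scalerA.
by rewrite !size_cat.
Qed.

Lemma multilinear_sum_rem_at (c : nat -> nat -> K) F :
  (forall s, linear (F^~ s)) -> (forall v, multilinear (F v)) ->
  multilinear (fun s => \sum_(k < size s) c (size s) k *: F s`_k (rem_at k s)).
Proof.
move=> F1 F2 s1 s2 a x y; rewrite !size_cat /= scaler_sumr -big_split /=.
apply: eq_bigr => -[k hk] _ /=; rewrite scalerA [a * _]mulrC -scalerA -scalerDr.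
congr (_ *: _); rewrite /rem_at !nth_cat !take_cat !drop_cat.
have [lt_k|] := ltnP k (size s1).
  have [lt_k1|] := ltnP k.+1 (size s1); first by rewrite !catA -!F2.
  move=> hk1; have -> : k.+1 = size s1 by apply/eqP; rewrite eqn_leq lt_k.
  by rewrite subnn !drop0 F2.
move=> le_k; rewrite ltnNge (leq_trans le_k (leqnSn _)) /= subSn // /=.
case: (k - size s1)%N => [|j] /=; first by rewrite cats0 F1.
by rewrite -!catA /= F2.
Qed.
End RemoveFactor.
End TensorAlgebra.

Arguments tens {K V}.
Arguments vacuum {K V}.
Arguments fock_ext {K V W g}.

(* The pair (x, y) stands for x + i y. *)
Definition complexification (R : realType) (V : lmodType R) : Type := (V * V)%type.

Section Complexification.
Variables (R : realType) (V : lmodType R).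
Local Notation H := (complexification V).

HB.instance Definition _ := GRing.Zmodule.on H.

Definition complexification_scale (c : R[i]) (u : H) : H :=
  (complex.Re c *: u.1 - complex.Im c *: u.2,
   complex.Re c *: u.2 + complex.Im c *: u.1).

Let scaleA a b u : complexification_scale a (complexification_scale b u)
  = complexification_scale (a * b) u.
Proof.
case: a b => [a a'] [b b']; rewrite /complexification_scale /=; congr (_, _).
  rewrite !(scalerBr, scalerDr, scalerBl, scalerDl) !scalerA !opprD.
  by rewrite [in RHS]addrACA; congr (_ + _); rewrite addrC.
rewrite !(scalerBr, scalerDr, scalerBl, scalerDl) !scalerA.
by rewrite [in RHS]addrACA; congr (_ + _); rewrite addrC.
Qed.

Let scale1 : left_id 1 complexification_scale.
Proof.
by case=> u v; rewrite /complexification_scale /= !scale1r !scale0r subr0 addr0.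
Qed.

Let scaleDr : right_distributive complexification_scale +%R.
Proof.
move=> a u v; rewrite /complexification_scale /=; congr (_, _).
  by rewrite !scalerDr opprD addrACA.
by rewrite !scalerDr addrACA.
Qed.

Let scaleDl u : {morph complexification_scale^~ u : a b / a + b}.
Proof.
move=> [a a'] [b b']; rewrite /complexification_scale /=; congr (_, _).
  by rewrite !scalerDl opprD addrACA.
by rewrite !scalerDl addrACA.
Qed.

HB.instance Definition _ := GRing.Zmodule_isLmodule.Build R[i] H
  scaleA scale1 scaleDr scaleDl.

Definition real_vec (x : V) : H := (x, 0).

Variable dot : {dot V for idfun}.

(* The extension of [dot], linear in the right and antilinear in the left
   argument. *)
Definition cdot (u v : H) : R[i] :=
  (dot u.1 v.1 + dot u.2 v.2) +i* (dot u.1 v.2 - dot u.2 v.1).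

Lemma cdot_linear u : linear_for *%R (cdot u).
Proof.
move=> [a b] [v v'] [w w']; rewrite /cdot /=.
rewrite !(linearDr, linearNr, linearZr_LR) /=; congr Complex; ring.
Qed.

Lemma cdotC u v : (cdot u v)^* = cdot v u.
Proof.
have dC y z : dot y z = dot z y.
  by rewrite (@hermitian_subproof _ _ false _ dot) expr0 mul1r.
by rewrite /cdot /= opprB !(dC v.1) !(dC v.2).
Qed.

Definition cnorm (u : H) : R := Num.sqrt (complex.Re (cdot u u)).

Definition bounded_operator (T : H -> H) : Prop :=
  exists M : R, forall u, cnorm (T u) <= M * cnorm u.

Definition selfadjoint (T : H -> H) : Prop :=
  forall u v, cdot u (T v) = cdot (T u) v.
End Complexification.

Section Hyperoctahedral.
Variable n : nat.

(* (false, i) stands for the letter i + 1 and (true, i) for -(i + 1). *)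
Definition letter : predArgType := (bool * 'I_n)%type.
Definition opp_letter (u : letter) : letter := (~~ u.1, u.2).

Definition hyperoctahedral : {set {perm letter}} :=
  [set s : {perm letter} | [forall u, s (opp_letter u) == opp_letter (s u)]]%SET.

(* The generator pi_i: the sign change of the first letter for i = 0, and the
   exchange of the i-th and the (i+1)-th letters for 0 < i < n. *)
Definition hgen (i : 'I_n) : {perm letter} :=
  if i == 0%N :> nat then tperm (false, i) (true, i)
  else (tperm (false, ord_pred i) (false, i) * tperm (true, ord_pred i) (true, i))%g.

Definition reduced_word (s : {perm letter}) (w : seq 'I_n) : Prop :=
  (\prod_(i <- w) hgen i)%g = s /\
  forall w', (\prod_(i <- w') hgen i)%g = s -> (size w <= size w')%N.

(* The numbers of occurrences below do not depend on the chosen reduced word. *)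
Definition some_reduced_word s : seq 'I_n := xget [::] (reduced_word s).

Definition len1 s := count (fun i : 'I_n => i == 0%N :> nat) (some_reduced_word s).
Definition len2 s := count (fun i : 'I_n => i != 0%N :> nat) (some_reduced_word s).
End Hyperoctahedral.

Section FockB.
Variables (R : realType) (V : lmodType R) (dot : {dot V for idfun}).
Local Notation H := (complexification V).
Local Notation F := (fock H).
Variables (bar : {linear H -> H}) (alpha q : R).
Local Notation ac := (alpha%:C).
Local Notation qc := (q%:C).

Section Action.
Variable n : nat.

Definition letter_entry (w : seq H) (u : letter n) : H :=
  if u.1 then bar w`_u.2 else w`_u.2.

(* The entry at position j is the s(j)-th factor, where the (-k)-th factor is the
   image under bar of the k-th one. As the product s * t of permutations applies s
   first, hact (s * t) is hact s \o hact t when bar is an involution. *)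
Definition hact (s : {perm letter n}) (w : seq H) : seq H :=
  [seq letter_entry w (s (false, j)) | j <- enum 'I_n].
End Action.

Lemma hact_multilinear n (s : {perm letter n}) s1 s2 :
  s \in hyperoctahedral n -> (size s1 + (size s2).+1)%N = n ->
  forall c y z, tens (hact s (s1 ++ (c *: y + z) :: s2))
    = c *: tens (hact s (s1 ++ y :: s2)) + tens (hact s (s1 ++ z :: s2)).
Proof.
rewrite inE => /forallP hs eq_sz c y z.
have lt_m : (size s1 < n)%N by rewrite -eq_sz -addSnnS leq_addr.
pose m : 'I_n := Ordinal lt_m.
have [b [j sj]] : exists b j, s (false, j) = (b, m).
  case def_u: ((s^-1)%g (false, m)) => [[] j].
    exists true, j; have /eqP := hs (true, j).
    by rewrite /opp_letter /= -def_u permKV.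
  by exists false, j; rewrite -def_u permKV.
have sne k : k != j -> (s (false, k)).2 != m.
  move=> /eqP ne_kj; apply/eqP => sk.
  have [eq_b|ne_b] := eqVneq (s (false, k)).1 b.
    have : s (false, k) = s (false, j) by rewrite sj -eq_b -sk; case: (s _).
    by move/perm_inj => [].
  have : s (false, k) = s (true, j).
    have /eqP -> := hs (false, j); rewrite sj /opp_letter /=.
    by move: ne_b sk; case: (s (false, k)) => [[] ?]; case: b {sj} => //= _ ->.
  by move/perm_inj.
have entry_const v w k : k != j -> letter_entry (s1 ++ v :: s2) (s (false, k))
    = letter_entry (s1 ++ w :: s2) (s (false, k)).
  move=> /sne ne_m; rewrite /letter_entry !nth_cat; case: ltnP => // le_k.
  rewrite -[((s _).2 - _)%N]prednK //.
  by rewrite subn_gt0 ltn_neqAle le_k andbT eq_sym.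
have j_enum : j \in enum 'I_n by rewrite mem_enum.
rewrite /hact; case/splitPr: j_enum (enum_uniq 'I_n) => p1 p2.
rewrite cat_uniq /= negb_or => /and3P[_ /andP[jp1 _] /andP[jp2 _]].
have map_const (p : seq 'I_n) v : j \notin p ->
  [seq letter_entry (s1 ++ v :: s2) (s (false, k)) | k <- p]
  = [seq letter_entry (s1 ++ 0 :: s2) (s (false, k)) | k <- p].
  move=> jp; apply/seq.eq_in_map => k kp; apply: entry_const.
  by apply: contraNneq jp => <-.
rewrite !map_cat /= !(map_const p1) // !(map_const p2) //.
have entry_j v : letter_entry (s1 ++ v :: s2) (s (false, j)) = if b then bar v else v.
  by rewrite sj /letter_entry /= nth_cat ltnn subnn.
by rewrite !entry_j; case: b {sj sne entry_j} => /=; rewrite ?linearP tens_multilinear.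
Qed.

Definition symm_formula (w : seq H) : F :=
  \sum_(s in hyperoctahedral (size w))
    (ac ^+ len1 s * qc ^+ len2 s) *: tens (hact s w).

Lemma symm_multilinear : multilinear symm_formula.
Proof.
move=> s1 s2 c y z; rewrite /symm_formula !size_cat /= scaler_sumr -big_split /=.
apply: eq_bigr => s hs; rewrite hact_multilinear // scalerDr !scalerA.
by rewrite [_ * c]mulrC.
Qed.

(* The direct sum over n of the operators P^(n). *)
Definition symm : F -> F := fock_ext symm_multilinear.

Definition word_dot (v w : seq H) : R[i]^o :=
  if size v == size w then \prod_(i < size v) cdot dot v`_i w`_i else 0.

Lemma word_dot_multilinear v : multilinear (word_dot v).
Proof.
move=> s1 s2 c y z; rewrite /word_dot !size_cat /=.
case: eqP => [eq_sz|_]; last by rewrite scaler0 addr0.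
have lt_sz : (size s1 < size v)%N by rewrite eq_sz -addSnnS leq_addr.
have split_m x : \prod_(i < size v) cdot dot v`_i (s1 ++ x :: s2)`_i =
    cdot dot v`_(size s1) x *
    \prod_(i < size v | i != Ordinal lt_sz) cdot dot v`_i (s1 ++ 0 :: s2)`_i.
  rewrite (bigD1 (Ordinal lt_sz)) //= nth_cat ltnn subnn /=; congr (_ * _).
  apply: eq_bigr => i ne_i; rewrite !nth_cat; case: ltnP => // le_i.
  by rewrite -[(i - _)%N]prednK // subn_gt0 ltn_neqAle le_i andbT eq_sym.
by rewrite !split_m cdot_linear mulrDl -mulrA.
Qed.

Definition word_dot_ext (v : seq H) : F -> R[i] :=
  fock_ext (word_dot_multilinear v).

Lemma word_dotC v w : (word_dot v w)^* = word_dot w v.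
Proof.
rewrite /word_dot eq_sym; case: eqP => [->|_]; last exact: conjc0.
by rewrite rmorph_prod; apply: eq_bigr => i _; apply: cdotC.
Qed.

Lemma word_dot_ext_multilinear (f : F) :
  multilinear (fun v => (word_dot_ext v f)^* : R[i]^o).
Proof.
move=> s1 s2 c y z; elim/fock_ind: f => [|d w f IH].
  by rewrite /word_dot_ext !raddf0 addr0.
rewrite /word_dot_ext !linearP -!/(word_dot_ext _ _) !rmorphD !rmorphM /= IH.
rewrite !fock_ext_tens !word_dotC word_dot_multilinear scalerDr.
rewrite addrACA; congr (_ + _).
by rewrite mulrDr; congr (_ + _); rewrite /GRing.scale /=; ring.
Qed.

Definition fock_dot0 (f g : F) : R[i] :=
  (fock_ext (word_dot_ext_multilinear g) f)^*.

Lemma fock_dot0_tens v w : fock_dot0 (tens v) (tens w) =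
  if size v == size w then \prod_(i < size v) cdot dot v`_i w`_i else 0.
Proof. by rewrite /fock_dot0 fock_ext_tens conjcK /word_dot_ext fock_ext_tens. Qed.

Definition fock_dot (f g : F) : R[i] := fock_dot0 f (symm g).

Definition vacuum_state (X : F -> F) : R[i] := fock_dot vacuum (X vacuum).

(* The factors are numbered from 0 here, hence the shifts of the exponents. *)
Definition annihilation_formula (x : H) (w : seq H) : F :=
  \sum_(k < size w)
     qc ^+ (size w - k.+1) *: (cdot dot x w`_k *: tens (rem_at k w)) +
  (ac * qc ^+ (size w).-1) *: \sum_(k < size w)
     qc ^+ k *: (cdot dot x (bar w`_k) *: tens (rem_at k w)).

Lemma annihilation_multilinear x : multilinear (annihilation_formula x).
Proof.
apply: multilinearD; last apply: (multilinearZ (fun m => ac * qc ^+ m.-1)).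
  apply: (multilinear_sum_rem_at (fun m k => qc ^+ (m - k.+1))
            (F := fun v w => cdot dot x v *: tens w)) => [w c y z|v].
    by rewrite cdot_linear scalerDl scalerA.
  exact: (@multilinearZ _ _ _ (fun=> cdot dot x v) _ (@tens_multilinear _ _)).
apply: (multilinear_sum_rem_at (fun=> fun k => qc ^+ k)
          (F := fun v w => cdot dot x (bar v) *: tens w)) => [w c y z|v].
  by rewrite linearP cdot_linear scalerDl scalerA.
exact: (@multilinearZ _ _ _ (fun=> cdot dot x (bar v)) _ (@tens_multilinear _ _)).
Qed.

Definition annihilation x : F -> F := fock_ext (annihilation_multilinear x).

Lemma creation_multilinear (x : H) :
  multilinear (fun w => tens (rcons w x) : F).
Proof. by move=> s1 s2 c y z; rewrite !rcons_cat /= tens_multilinear. Qed.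

Definition creation x : F -> F := fock_ext (creation_multilinear x).

Section Gauge.
Variable T : {linear H -> H}.

Definition gauge_formula (w : seq H) : F :=
  \sum_(k < size w)
     qc ^+ (size w - k.+1) *: tens (rcons (rem_at k w) (T w`_k)) +
  (ac * qc ^+ (size w).-1) *: \sum_(k < size w)
     qc ^+ k *: tens (rcons (rem_at k w) (T (bar w`_k))).

Lemma gauge_multilinear : multilinear gauge_formula.
Proof.
apply: multilinearD; last apply: (multilinearZ (fun m => ac * qc ^+ m.-1)).
  apply: (multilinear_sum_rem_at (fun m k => qc ^+ (m - k.+1))
            (F := fun v w => tens (rcons w (T v)))) => [w c y z|v].
    by rewrite -!cats1 linearP tens_multilinear.
  exact: creation_multilinear.
apply: (multilinear_sum_rem_at (fun=> fun k => qc ^+ k)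
          (F := fun v w => tens (rcons w (T (bar v))))) => [w c y z|v].
  by rewrite -!cats1 !linearP tens_multilinear.
exact: creation_multilinear.
Qed.

Definition gauge : F -> F := fock_ext gauge_multilinear.
End Gauge.

Definition field_op (T : V -> {linear H -> H}) (lambda : R) (x : V) (f : F) : F :=
  annihilation (real_vec x) f + creation (real_vec x) f + gauge (T x) f
  + lambda%:C *: f.
End FockB.

Section TypeBPartitions.
Variable n : nat.
Local Notation partn := {set {set 'I_n}}.
Local Notation pair := ('I_n * 'I_n)%type.

Definition arc (P : partn) (e : pair) : bool :=
  [exists B in P, [&& e.1 \in B, e.2 \in B, (e.1 < e.2)%N
                   & [forall k in B, (e.1 < k)%N ==> (e.2 <= k)%N]]].

(* A coloring is encoded by the function which is true exactly at the arcs of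
   color -1; singleton blocks have color 1 and carry no information. *)
Definition partitionB : {set partn * {ffun pair -> bool}} :=
  [set pf : partn * {ffun pair -> bool} |
    finset.partition pf.1 [set: 'I_n] && [forall e, pf.2 e ==> arc pf.1 e]]%SET.

Definition distinct_blocks (P : partn) (e e' : pair) : bool :=
  finset.pblock P e.1 != finset.pblock P e'.1.

(* Each crossing is counted once, with its left arc in first position. *)
Definition rc (P : partn) : nat :=
  #|[set ee : pair * pair | [&& arc P ee.1, arc P ee.2,
      distinct_blocks P ee.1 ee.2
      & [&& ee.1.1 < ee.2.1, ee.2.1 < ee.1.2 & ee.1.2 < ee.2.2]%N]]%SET|.

Definition rnarc (P : partn) (f : {ffun pair -> bool}) : nat :=
  #|[set ee : pair * pair | [&& arc P ee.1, arc P ee.2,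
      distinct_blocks P ee.1 ee.2, f ee.2
      & [&& ee.1.1 < ee.2.1, ee.2.1 < ee.2.2 & ee.2.2 < ee.1.2]%N]]%SET|.

Definition Narc (P : partn) (f : {ffun pair -> bool}) : nat :=
  #|[set e : pair | arc P e && f e]%SET|.
End TypeBPartitions.

Section Cumulants.
Variables (R : realType) (V : lmodType R) (dot : {dot V for idfun}).
Local Notation H := (complexification V).
Variables (bar : {linear H -> H}) (T : V -> {linear H -> H}).
Variables (n : nat) (x : 'I_n -> V) (lambda : 'I_n -> R).
Variable f : {ffun 'I_n * 'I_n -> bool}.

(* u is the vector reached at the element i of the block, and j :: s lists the
   elements of the block above i. *)
Fixpoint block_walk (u : H) (i j : 'I_n) (s : seq 'I_n) : R[i] :=
  let v := if f (i, j) then bar u else u in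
  match s with
  | [::] => cdot dot (real_vec (x j)) v
  | k :: s' => block_walk (T (x j) v) j k s'
  end.

(* enum lists the elements of a block in increasing order. *)
Definition block_cumulant (B : {set 'I_n}) : R[i] :=
  match enum B with
  | [::] => 1
  | [:: i] => (lambda i)%:C
  | i :: j :: s => block_walk (real_vec (x i)) i j s
  end.

Definition cumulant (P : {set {set 'I_n}}) : R[i] := \prod_(B in P) block_cumulant B.
End Cumulants.

(* Main.v *)
Require Import Defs.
From HB Require Import structures.
From mathcomp Require Import all_boot all_order all_algebra perm.
From mathcomp Require Import sesquilinear.
From mathcomp Require Import boolp classical_sets cardinality reals.
From mathcomp Require Import topology normedtype.
From mathcomp Require Import complex.

(** The vacuum expectation is a sum over histories, and a history is the same
    thing as a colored partition.

    On an elementary tensor each field operator makes one of finitely many moves: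
    append its vector (open a block), multiply by lambda (a singleton block),
    contract a tensor factor (end a block), or replace a factor by its image under
    T, moved to the end (continue a block).  The last two come in two colors, the
    color -1 applying bar and carrying the coefficient alpha.  Label each tensor
    factor by the time at which it was appended.  Then the word is at every time the
    increasing list of the elements whose block is still open, so that applying the
    operators to the vacuum gives a weighted sum over histories of moves
    ([fields_vacuum]).  The vacuum is orthogonal to all words but the empty one,
    hence only the histories that end with no open block contribute
    ([vacuum_state_fields]).

    The source of the move at time j, when there is one, is the left end i of the
    arc (i, j).  In this way histories without open blocks at the end correspond to
    the colored partitions of [n] ([perm_histories]).

    It remains to identify the weight of the history of a partition
    ([weight_move_of]).  When the factor labelled i is taken at time j out of a word
    in which r labels exceed i and l labels lie below i, the operators give q^r for
    the color 1 and alpha q^(r + l) q^l for the color -1, since the word has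
    r + l + 1 factors.  Every other label in the word is the left end of an arc that
    ends after j: those above i give the arcs that cross (i, j) from the right, those
    below i the arcs that nest (i, j).  So r sums to rc, and 2 l, counted for
    the color -1 only, sums to 2 rnarc.  The scalar products and the scalars lambda
    come at the greatest elements of the blocks, one for each block, and are the
    cumulants ([block_cumulant_prod]). *)

Set Implicit Arguments.
Unset Strict Implicit.
Unset Printing Implicit Defensive.

Local Notation arc := Defs.arc.

(** * Histories *)

(** Some (i, c), b encodes a move that takes the factor labelled i, with color -1
    when c is true; b tells whether the block stays open.  Without a source the move
    starts a block, which is a singleton when b is false. *)
Definition move := (option (nat * bool) * bool)%type.

Definition release (A : seq nat) (src : option (nat * bool)) : seq nat :=
  if src is Some e then rem e.1 A else A.

(** Histories are listed with the latest move first, so that the size of the tail is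
    the time of the head. *)
Fixpoint opens (h : seq move) : seq nat :=
  if h is mv :: h' then
    release (opens h') mv.1 ++ (if mv.2 then [:: size h'] else [::])
  else [::].

Definition moves (A : seq nat) : seq move :=
  [seq (src, b) | src <- None :: [seq Some (i, c) | i <- A, c <- [:: false; true]],
                  b <- [:: false; true]].

Fixpoint histories (m : nat) : seq (seq move) :=
  if m is m'.+1 then [seq mv :: h | h <- histories m', mv <- moves (opens h)]
  else [:: [::]].

Lemma historiesS m :
  histories m.+1 = [seq mv :: h | h <- histories m, mv <- moves (opens h)].
Proof. by []. Qed.

(** A value attached to each element of [n] and propagated along its block.  It is
    used twice: for the vector that the block has reached, and for the least element
    of the block. *)
Fixpoint trace (X : Type) (start : nat -> X) (pass : nat -> bool -> X -> X)
    (h : seq move) : nat -> X :=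
  if h is mv :: h' then
    fun i => if i != size h' then trace start pass h' i
             else if mv.1 is Some e then pass i e.2 (trace start pass h' e.1)
             else start i
  else start.

Fixpoint history (g : nat -> move) (m : nat) : seq move :=
  if m is m'.+1 then g m' :: history g m' else [::].

Definition used (g : nat -> move) (m i : nat) : bool :=
  has (fun j => omap fst (g j).1 == Some i) (iota 0 m).

(** A sequence of moves can be performed when each source is open at its time.  For
    the arcs (i, j) this says that the left end comes first, was left open, and has
    no other arc to its right. *)
Definition legal (g : nat -> move) (m : nat) : Prop :=
  forall j i c, j < m -> (g j).1 = Some (i, c) ->
    [&& i < j, (g i).2 & ~~ used g j i].

(** Labels are appended in the order of time, so the word is sorted: the positions
    of the factors, on which the exponents of q depend, are counts of labels. *)
Lemma opens_wf h : sorted ltn (opens h) && all (gtn (size h)) (opens h).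
Proof.
elim: h => //= mv h /andP[srt bnd].
have srt' : sorted ltn (release (opens h) mv.1).
  case: mv.1 => //= e; apply: subseq_sorted srt; last exact: rem_subseq.
  exact: ltn_trans.
have bnd' : all (gtn (size h)) (release (opens h) mv.1).
  case: mv.1 => //= e; apply/allP => i /mem_rem; exact: (allP bnd).
have bnd'' : all (gtn (size h).+1) (release (opens h) mv.1).
  by apply: sub_all bnd' => i /= /ltnW.
case: mv.2; last by rewrite cats0 srt'.
rewrite all_cat bnd'' /= ltnSn !andbT.
by rewrite (sorted_pairwise ltn_trans) pairwise_cat -(sorted_pairwise ltn_trans)
  srt' allrel1r bnd'.
Qed.

Lemma opens_sorted h : sorted ltn (opens h).
Proof. by case/andP: (opens_wf h). Qed.

Lemma opens_lt h i : i \in opens h -> i < size h.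
Proof. by case/andP: (opens_wf h) => _ /allP; apply. Qed.

Lemma opens_uniq h : uniq (opens h).
Proof. exact: sorted_uniq ltn_trans ltnn _ (opens_sorted h). Qed.

Lemma size_history g m : size (history g m) = m.
Proof. by elim: m => //= m ->. Qed.

Lemma eq_history g g' m : (forall j, j < m -> g j = g' j) ->
  history g m = history g' m.
Proof.
elim: m => //= m IH eq_g; rewrite eq_g // IH // => j lt_jm.
exact/eq_g/ltnW.
Qed.

Lemma history_inj g g' m j : history g m = history g' m -> j < m -> g j = g' j.
Proof.
elim: m => //= m IH [eq_m eq_h].
rewrite ltnS leq_eqVlt => /predU1P[->|]; [exact: eq_m|].
exact: IH.
Qed.

Lemma usedP g m i :
  reflect (exists j c, j < m /\ (g j).1 = Some (i, c)) (used g m i).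
Proof.
apply: (iffP hasP) => [[j]|[j [c [lt_jm gj]]]].
  rewrite mem_iota /= add0n => lt_jm.
  by case def_g: (g j).1 => [[i' c]|] //= /eqP[<-]; exists j, c.
by exists j; rewrite ?mem_iota // gj.
Qed.

Lemma usedS g m i : used g m.+1 i = used g m i || (omap fst (g m).1 == Some i).
Proof. by rewrite /used -addn1 iotaD has_cat /= orbF add0n. Qed.

Lemma legalS g m : legal g m.+1 -> legal g m.
Proof. by move=> lg j i c lt_jm; apply/lg/ltnW. Qed.

Lemma used_lt g m i : legal g m -> used g m i -> i < m.
Proof.
move=> lg /usedP[j [c [lt_jm /(lg _ _ _ lt_jm)/andP[lt_ij _]]]].
exact: ltn_trans lt_ij lt_jm.
Qed.

Lemma legal_inj g m i c c' j j' : legal g m -> j < m -> j' < m ->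
  (g j).1 = Some (i, c) -> (g j').1 = Some (i, c') -> j = j'.
Proof.
move=> lg; wlog lt_jj' : c c' j j' / j < j' => [IH|] jm j'm gj gj'.
  case: (ltngtP j j') => // [lt|gt]; first exact: (IH c c').
  by apply/esym; apply: (IH c' c).
have /and3P[_ _ /negP[]] := lg _ _ _ j'm gj'.
by apply/usedP; exists j, c.
Qed.

Lemma mem_opens g m i : legal g m ->
  (i \in opens (history g m)) = [&& i < m, (g i).2 & ~~ used g m i].
Proof.
elim: m => [|m IH] lg /=; first by rewrite in_nil.
have {}IH := IH (legalS lg).
have memr : (i \in release (opens (history g m)) (g m).1)
    = [&& i < m, (g i).2 & ~~ used g m.+1 i].
  rewrite usedS /release; case: (g m).1 => [[k c]|] /=; last by rewrite orbF.
  rewrite mem_rem_uniq ?opens_uniq // inE IH eq_sym.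
  rewrite -[Some k == Some i]/(k == i).
  by case: eqP; rewrite ?orbF ?orbT ?andbF.
rewrite mem_cat memr size_history ltnS.
have [->|ne_im] := eqVneq i m.
  have nu : ~~ used g m.+1 m.
    rewrite usedS negb_or; apply/andP; split.
      by apply/negP => /(used_lt (legalS lg)); rewrite ltnn.
    apply/eqP; case def_g: (g m).1 => [[k c]|] //= [eq_k].
    by have /andP[] := lg _ _ _ (ltnSn m) def_g; rewrite eq_k ltnn.
  by rewrite ltnn leqnn nu; case: (g m).2; rewrite /= ?mem_seq1 ?eqxx.
rewrite [i <= m]leq_eqVlt (negPf ne_im) /= -[RHS]orbF; congr orb.
by case: (g m).2; rewrite /= ?mem_seq1 ?(negPf ne_im).
Qed.

Lemma mem_moves A mv :
  (mv \in moves A) = (if mv.1 is Some e then e.1 \in A else true).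
Proof.
have bP (b : bool) : b \in [:: false; true] by case: b.
case: mv => src b; apply/allpairsPdep/idP => [[src' [b' [src_in _ [-> _]]]]|].
  case: src' src_in => [e|//]; rewrite in_cons => /predU1P[//|].
  by case/allpairsPdep=> i [c [iA _ [->]]].
case: src => [[i c]|] hsrc; [exists (Some (i, c)), b | by exists None, b].
split=> //; rewrite in_cons; apply/orP; right.
by apply/allpairsPdep; exists i, c.
Qed.

Lemma moves_uniq A : uniq A -> uniq (moves A).
Proof.
move=> uA; apply: allpairs_uniq => //; last by case=> ? ? [].
rewrite cons_uniq allpairs_uniq //; last by move=> [? ?] [? ?] _ _ [-> ->].
by rewrite andbT; apply/allpairsPdep => -[i [c []]].
Qed.

Lemma histories_uniq m : uniq (histories m).
Proof.
elim: m => // m IH; rewrite historiesS.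
apply: allpairs_uniq_dep => // [h _|].
  exact/moves_uniq/opens_uniq.
by move=> [h mv] [h' mv'] _ _ /= [-> ->].
Qed.

(** A function on nat describes a history without reference to earlier moves, which
    is the form needed to compare histories with sets of arcs. *)
Lemma mem_histories h m :
  h \in histories m <-> exists2 g, legal g m & h = history g m.
Proof.
split=> [|[g lg ->]].
  elim: m h => [|m IH] h.
    by rewrite inE => /eqP->; exists (fun=> (None, false)).
  rewrite historiesS; case/allpairsPdep=> h' [mv [h'_in mv_in ->]].
  have [g lg def_h'] := IH _ h'_in.
  pose g' j := if j == m then mv else g j.
  have g'E j : j < m -> g' j = g j by rewrite /g'; case: ltngtP.
  have usedE j i : j <= m -> used g' j i = used g j i.
    move=> le_jm; apply: eq_in_has => k; rewrite mem_iota add0n => /andP[_ lt_kj].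
    by rewrite g'E // (leq_trans lt_kj).
  exists g'; last by rewrite /= {1}/g' eqxx def_h' (eq_history g'E).
  move=> j i c; rewrite ltnS leq_eqVlt => /predU1P[->|lt_jm].
    rewrite {1}/g' eqxx => def_mv; move: mv_in.
    rewrite mem_moves def_mv /= def_h' mem_opens // usedE //.
    by case/and3P=> lt_im gi nu; rewrite lt_im g'E // gi.
  rewrite g'E // => gj; have /and3P[lt_ij gi nu] := lg _ _ _ lt_jm gj.
  by rewrite lt_ij g'E ?(ltn_trans lt_ij) // gi usedE ?nu // ltnW.
elim: m lg => // m IH lg; rewrite historiesS; apply/allpairsPdep.
exists (history g m), (g m); split=> //; first exact/IH/legalS.
rewrite mem_moves; case def_g: (g m).1 => [[i c]|] //=.
by rewrite mem_opens ?(lg _ _ _ (ltnSn m) def_g) //; apply: legalS.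
Qed.

Section Trace.
Variables (X : Type) (start : nat -> X) (pass : nat -> bool -> X -> X).
Local Notation tr := (trace start pass).

Lemma trace_history g m i : i < m -> tr (history g m) i = tr (history g i.+1) i.
Proof.
elim: m => // m IH; rewrite ltnS leq_eqVlt => /predU1P[-> //|lt_im].
by rewrite -IH //= size_history; case: ltngtP lt_im.
Qed.

Lemma trace_last g m j : legal g m -> j < m -> tr (history g m) j =
  if (g j).1 is Some e then pass j e.2 (tr (history g m) e.1) else start j.
Proof.
move=> lg lt_jm; rewrite trace_history //= size_history eqxx /=.
case def_g: (g j).1 => [[i c]|] //=; congr (pass _ _ _).
have /andP[lt_ij _] := lg _ _ _ lt_jm def_g.
by rewrite trace_history // [RHS]trace_history // (ltn_trans lt_ij).
Qed.
End Trace.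

(** * Arcs of partitions *)

Section Linked.
Variable n : nat.
Local Notation pair := ('I_n * 'I_n)%type.
Local Notation setT := (finset.setTfor 'I_n).

(** The arcs of the partition into the level sets of b.  Labelled elements serve both
    for a given partition, with b = pblock P, and for the partition built from a
    history, with b the least element of the block. *)
Definition linked (X : eqType) (b : 'I_n -> X) (i j : 'I_n) : bool :=
  [&& b i == b j, i < j & [forall k, (b k == b i) && (i < k) ==> (j <= k)]].

Section Label.
Variables (X : eqType) (b : 'I_n -> X).
Implicit Types i j k : 'I_n.

Lemma linkedP i j :
  reflect [/\ b i = b j, i < j & forall k, b k = b i -> i < k -> j <= k]
    (linked b i j).
Proof.
apply: (iffP and3P) => -[].
  move=> /eqP eq_b lt_ij /forallP no; split=> // k bk lt_ik.
  by have /implyP := no k; rewrite bk eqxx lt_ik; apply.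
move=> -> -> no; rewrite eqxx; split=> //; apply/forallP => k.
by apply/implyP => /andP[/eqP]; apply: no.
Qed.

Lemma linked_lt i j : linked b i j -> i < j.
Proof. by case/linkedP. Qed.

Lemma linked_fun i j j' : linked b i j -> linked b i j' -> j = j'.
Proof.
move=> /linkedP[bij lt_ij no] /linkedP[bij' lt_ij' no'].
by apply/val_inj/eqP; rewrite /= eqn_leq no ?no'.
Qed.

Lemma linked_inj i i' j : linked b i j -> linked b i' j -> i = i'.
Proof.
move=> /linkedP[bij lt_ij no] /linkedP[bij' lt_ij' no']; apply/val_inj => /=.
case: (ltngtP i i') => // [lt|gt].
  by have := no i' (etrans bij' (esym bij)) lt; rewrite leqNgt lt_ij'.
by have := no' i (etrans bij (esym bij')) gt; rewrite leqNgt lt_ij.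
Qed.

Lemma linked_pred i j : b i = b j -> i < j -> exists2 k, linked b k j & i <= k.
Proof.
move=> bij lt_ij; pose Q k := (b k == b j) && (k < j).
have Qi : Q i by rewrite /Q bij eqxx.
case: (@arg_maxnP _ i Q val Qi) => k /andP[/eqP bk lt_kj] max_k.
exists k; last exact: max_k.
apply/linkedP; split=> // l bl lt_kl; rewrite leqNgt; apply/negP => lt_lj.
have := max_k l; rewrite /Q bl bk eqxx lt_lj => /(_ isT).
by rewrite /= leqNgt lt_kl.
Qed.
End Label.

(** The arcs determine the blocks: descend from j along the arcs of its block until i
    is reached. *)
Lemma eq_linked (X Y : eqType) (b : 'I_n -> X) (c : 'I_n -> Y) :
  (forall i j, linked b i j -> linked c i j) ->
  forall i j, b i = b j -> c i = c j.
Proof.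
move=> lk; suff main m (i j : 'I_n) : j < m -> i < j -> b i = b j -> c i = c j.
  move=> i j; case: (ltngtP i j) => [lt|gt|/val_inj-> //].
    exact: main (ltnSn j) lt.
  by move/esym/(main _ _ _ (ltnSn i) gt).
elim: m i j => // m IH i j lt_jm lt_ij bij.
have [k kj] := linked_pred bij lt_ij; have /linkedP[bk lt_kj _] := kj.
have /linkedP[ck _ _] := lk _ _ kj; rewrite -ck leq_eqVlt.
case/predU1P=> [/val_inj-> //|lt_ik].
by apply: IH => //; [rewrite (leq_trans lt_kj) | rewrite bij bk].
Qed.

Lemma arc_linked (P : {set {set 'I_n}}) i j : finset.partition P setT ->
  arc P (i, j) = linked (finset.pblock P) i j.
Proof.
case/and3P=> /eqP cov tiP _.
have inP k : k \in finset.cover P by rewrite cov finset.in_setT.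
apply/exists_inP/linkedP => /= [[B BP /and4P[iB jB lt_ij /forall_inP no]]|].
  rewrite !(def_pblock tiP BP) //; split=> // k pk.
  by apply/implyP/no; rewrite -pk mem_pblock.
case=> eq_p lt_ij no; exists (finset.pblock P i); first exact: pblock_mem.
rewrite mem_pblock inP {1}eq_p mem_pblock inP lt_ij /=.
apply/forall_inP => k ki; apply/implyP; apply: no.
exact: same_pblock.
Qed.

Lemma arc_preim (X : eqType) (b : 'I_n -> X) i j :
  arc (preim_partition b setT) (i, j) = linked b i j.
Proof.
have partP := preim_partitionP b setT.
have /and3P[/eqP cov tiP _] := partP.
have eqb k l : (finset.pblock (preim_partition b setT) k
    == finset.pblock (preim_partition b setT) l) = (b k == b l).
  rewrite eq_pblock ?cov // pblock_equivalence_partition //.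
  by move=> ? ? ? _ _ _; split=> // /eqP->.
rewrite arc_linked // /linked eqb; congr [&& _, _ & _].
by apply: eq_forallb => k; rewrite eqb.
Qed.

Lemma partition_arc_inj (P Q : {set {set 'I_n}}) :
  finset.partition P setT -> finset.partition Q setT -> arc P =1 arc Q -> P = Q.
Proof.
move=> partP partQ eq_arc.
have lk i j : linked (finset.pblock P) i j = linked (finset.pblock Q) i j.
  by rewrite -!arc_linked.
have eqb i j : (finset.pblock P i == finset.pblock P j)
    = (finset.pblock Q i == finset.pblock Q j).
  by apply/eqP/eqP; apply: eq_linked => k l; rewrite lk.
rewrite -(preim_partition_pblock partP) -(preim_partition_pblock partQ).
by apply: eq_imset => i; apply/finset.setP => j; rewrite !inE eqb.
Qed.
End Linked.

(** * Histories and colored partitions *)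

Section Encoding.
Variables (n : nat) (i0 : 'I_n).
Local Notation setT := (finset.setTfor 'I_n).
Local Notation ord := (insubd i0).
Implicit Types pf : {set {set 'I_n}} * {ffun 'I_n * 'I_n -> bool}.

(** The default i0 matters only at times j >= n, which no history of length n sees. *)
Definition move_of pf (j : nat) : move :=
  (omap (fun i : 'I_n => (val i, pf.2 (i, ord j))) [pick i | arc pf.1 (i, ord j)],
   [exists l, arc pf.1 (ord j, l)]).

Section Fixed.
Variables (P : {set {set 'I_n}}) (f : {ffun 'I_n * 'I_n -> bool}).
Hypothesis partP : finset.partition P setT.
Local Notation g := (move_of (P, f)).

Lemma source_move_ofP (j : 'I_n) e : reflect
  (exists2 i, arc P (i, j) & e = (val i, f (i, j))) ((g j).1 == Some e).
Proof.
rewrite /move_of /= valKd; case: pickP => [k kj|no] /=; last first.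
  by constructor=> -[k]; rewrite no.
apply: (iffP eqP) => [[<-]|[i ij ->]]; first by exists k.
by move: kj ij; rewrite !arc_linked // => /linked_inj kj /kj->.
Qed.

Lemma source_move_of (i j : 'I_n) : arc P (i, j) ->
  (g j).1 = Some (val i, f (i, j)).
Proof. by move=> ij; apply/eqP/source_move_ofP; exists i. Qed.

Lemma stays_move_of (j : 'I_n) : (g j).2 = [exists l, arc P (j, l)].
Proof. by rewrite /move_of /= valKd. Qed.

Lemma used_move_of (i : 'I_n) m : m <= n ->
  used g m i = [exists l : 'I_n, (l < m) && arc P (i, l)].
Proof.
move=> le_mn; apply/usedP/existsP => [[j [c [lt_jm gj]]]|[l /andP[lt_lm il]]].
  have lt_jn := leq_trans lt_jm le_mn.
  have /eqP/(@source_move_ofP (Ordinal lt_jn))[k kj [eq_ik _]] := gj.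
  by exists (Ordinal lt_jn); rewrite /= lt_jm (val_inj eq_ik).
by exists l, (f (i, l)); split=> //; apply: source_move_of.
Qed.

Lemma move_of_legal m : m <= n -> legal g m.
Proof.
move=> le_mn j k c lt_jm gj; have lt_jn := leq_trans lt_jm le_mn.
pose j' := Ordinal lt_jn.
have /eqP/(@source_move_ofP j')[i ij [-> _]] := gj.
have := ij; rewrite arc_linked // => lk.
rewrite (linked_lt lk) stays_move_of used_move_of 1?ltnW //=.
have -> : [exists l, arc P (i, l)] by apply/existsP; exists j'.
apply/existsPn => l; apply/negP => /andP[lt_lj].
rewrite arc_linked // => /(linked_fun lk) eq_jl.
by move: lt_lj; rewrite -eq_jl ltnn.
Qed.

(** The open elements at time m are the left ends of the arcs that end at m or
    later: this is where crossings and nestings come from. *)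
Lemma mem_opens_move_of (i : 'I_n) m : m <= n ->
  (val i \in opens (history g m))
  = (i < m) && [exists l : 'I_n, (m <= l) && arc P (i, l)].
Proof.
move=> le_mn; rewrite mem_opens; last exact: move_of_legal.
rewrite stays_move_of used_move_of //; congr andb.
apply/andP/existsP => [[/existsP[l il] /existsPn nu]|[l /andP[le_ml il]]].
  by exists l; have := nu l; rewrite il !andbT -leqNgt.
split; first by apply/existsP; exists l.
apply/existsPn => k; apply/negP => /andP[lt_km]; move: il; rewrite !arc_linked //.
by move=> /linked_fun lk /lk eq_lk; move: lt_km; rewrite -eq_lk ltnNge le_ml.
Qed.

Lemma opens_move_of_end : opens (history g n) = [::].
Proof.
apply/eqP; case def_o: (opens _) => [|i s] //.
have : i \in opens (history g n) by rewrite def_o mem_head.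
move=> io; have := opens_lt io; rewrite size_history => lt_in.
have := mem_opens_move_of (Ordinal lt_in) (leqnn n); rewrite io lt_in /=.
by case/esym/existsP=> l; rewrite leqNgt ltn_ord.
Qed.
End Fixed.

Lemma history_move_of_inj :
  {in partitionB n &, injective (fun pf => history (move_of pf) n)}.
Proof.
move=> [P f] [Q h]; rewrite !inE /= => /andP[pP /forallP fP] /andP[pQ /forallP hQ].
move=> eq_h; have eq_g (j : 'I_n) := history_inj eq_h (ltn_ord j).
have sub_arc P1 f1 P2 f2 : finset.partition P1 setT -> finset.partition P2 setT ->
    (forall j : 'I_n, move_of (P1, f1) j = move_of (P2, f2) j) ->
    forall i j, arc P1 (i, j) -> arc P2 (i, j) /\ f1 (i, j) = f2 (i, j).
  move=> p1 p2 eq_m i j ij; have := source_move_of f1 p1 ij.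
  rewrite eq_m => /eqP/(source_move_ofP _ p2)[k kj [eq_ik ->]].
  by rewrite (val_inj eq_ik).
have eq_arc : arc P =1 arc Q.
  case=> i j; apply/idP/idP => ij.
    by have [] := sub_arc _ f _ h pP pQ eq_g _ _ ij.
  by have [] := sub_arc _ h _ f pQ pP (fun j => esym (eq_g j)) _ _ ij.
congr (_, _); first exact: partition_arc_inj.
apply/ffunP => -[i j]; case ij: (arc P (i, j)).
  by have [] := sub_arc _ f _ h pP pQ eq_g _ _ ij.
have /implyP := fP (i, j); have /implyP := hQ (i, j); rewrite -eq_arc ij.
by case: (h _) => [/(_ isT)//|_]; case: (f _) => [/(_ isT)|].
Qed.

Section Surjective.
Variable g : nat -> move.
Hypotheses (lg : legal g n) (closed : opens (history g n) = [::]).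

(** Since each element has at most one arc to its left, following the arcs down to
    the least element identifies the block. *)
Definition least : nat -> nat := trace id (fun _ _ r => r) (history g n).

Lemma leastE j : j < n -> least j = if (g j).1 is Some e then least e.1 else j.
Proof. exact: trace_last. Qed.

Lemma least_le j : j < n -> least j <= j.
Proof.
elim/ltn_ind: j => j IH lt_jn; rewrite leastE //.
case gj: (g j).1 => [[i c]|] //=; have /andP[lt_ij _] := lg lt_jn gj.
by apply: leq_trans (IH _ lt_ij _) (ltnW lt_ij); apply: ltn_trans lt_jn.
Qed.

(** An element i between the ends of the arc (k, j) lies in another block.  Descend
    from i: as k has no arc to its right but (k, j), the descent stops above
    k or jumps over it, and then k itself lies between the ends of an arc of the
    block of i, with k < i. *)
Lemma least_between i j k c : j < n -> (g j).1 = Some (k, c) -> k < i < j ->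
  least i != least k.
Proof.
elim/ltn_ind: i j k c => i IH j k c lt_jn gj /andP[lt_ki lt_ij].
have lt_in := ltn_trans lt_ij lt_jn; have lt_kn := ltn_trans lt_ki lt_in.
rewrite (leastE lt_in); case gi: (g i).1 => [[l d]|] /=; last first.
  by rewrite gtn_eqF // (leq_ltn_trans (least_le lt_kn)).
have /andP[lt_li _] := lg lt_in gi.
case: (ltngtP l k) => [lt_lk|lt_kl|eq_lk].
- (* The roles of i and k are exchanged: k lies inside the arc (l, i). *)
  by rewrite eq_sym; apply: (IH k lt_ki i l d) => //; rewrite lt_lk.
- by apply: (IH l lt_li j k c) => //; rewrite lt_kl (ltn_trans lt_li).
rewrite eq_lk in gi; have eq_ij := legal_inj lg lt_in lt_jn gi gj.
by rewrite eq_ij ltnn in lt_ij.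
Qed.

Lemma linked_least (i j : 'I_n) :
  linked (fun k : 'I_n => least k) i j = (omap fst (g j).1 == Some (val i)).
Proof.
apply/linkedP/idP => [[eq_r lt_ij no]|].
  move: (eq_r); rewrite [least j]leastE //.
  case gj: (g j).1 => [[k c]|] /= eq_r'; last first.
    by have := least_le (ltn_ord i); rewrite eq_r' leqNgt lt_ij.
  have /andP[lt_kj _] := lg (ltn_ord j) gj.
  have lt_kn := ltn_trans lt_kj (ltn_ord j).
  case: (ltngtP i k) => [lt_ik|lt_ki|-> //].
    by have := no (Ordinal lt_kn) (esym eq_r') lt_ik; rewrite /= leqNgt lt_kj.
  have := least_between (ltn_ord j) gj (i := i).
  by rewrite lt_ki lt_ij eq_r' eqxx => /(_ isT).
case gj: (g j).1 => [[k c]|] //= /eqP[eq_k]; rewrite eq_k in gj.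
have /andP[lt_ij _] := lg (ltn_ord j) gj.
split=> //; first by rewrite [least j]leastE // gj.
move=> k' eq_r lt_ik; rewrite leqNgt; apply/negP => lt_kj.
have := least_between (ltn_ord j) gj (i := k').
by rewrite lt_ik lt_kj eq_r eqxx => /(_ isT).
Qed.

(** The blocks are the level sets of [least], and the color of an arc is that of the
    move at its right end. *)
Lemma closed_history_move_of :
  exists2 pf, pf \in partitionB n & history g n = history (move_of pf) n.
Proof.
pose P := preim_partition (fun k : 'I_n => least k) setT.
have partP : finset.partition P setT := preim_partitionP _ _.
have arcE i j : arc P (i, j) = (omap fst (g j).1 == Some (val i)).
  by rewrite arc_preim linked_least.
pose f := [ffun e : 'I_n * 'I_n => (g e.2).1 == Some (val e.1, true)].
exists (P, f).
  rewrite inE partP /=; apply/forallP => -[i j]; apply/implyP; rewrite ffunE arcE.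
  by move/eqP->.
apply: eq_history => j lt_jn; pose k := Ordinal lt_jn.
rewrite -[j]/(val k) [RHS]surjective_pairing [LHS]surjective_pairing.
rewrite stays_move_of; congr (_, _).
  case gk: (g k).1 => [[i c]|]; last first.
    apply/esym; case def: (move_of (P, f) k).1 => [e|] //.
    by have /eqP/(source_move_ofP _ partP)[l] := def; rewrite arcE gk.
  have /andP[lt_ij _] := lg (ltn_ord k) gk.
  have lt_in := ltn_trans lt_ij lt_jn.
  have ik : arc P (Ordinal lt_in, k) by rewrite arcE gk.
  rewrite (source_move_of f partP ik) ffunE -[(_, k).2]/k gk.
  have -> : (Some (i, c) == Some (val (Ordinal lt_in, k).1, true)) = c.
    by apply/eqP/idP => [[->]//|->].
  by [].
apply/idP/existsP => [gk|[l]].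
  have : val k \notin opens (history g n) by rewrite closed.
  rewrite mem_opens // ltn_ord gk /= negbK => /usedP[l [c [lt_ln gl]]].
  by exists (Ordinal lt_ln); rewrite arcE /= gl.
rewrite arcE; case gl: (g l).1 => [[i c]|] //= /eqP[eq_i].
by move: gl; rewrite eq_i => /(lg (ltn_ord l))/and3P[].
Qed.
End Surjective.

Lemma perm_histories :
  perm_eq [seq h <- histories n | opens h == [::]]
    [seq history (move_of pf) n | pf <- enum (partitionB n)].
Proof.
apply: uniq_perm; first exact/filter_uniq/histories_uniq.
  rewrite map_inj_in_uniq ?enum_uniq // => pf pf'; rewrite !mem_enum.
  exact: history_move_of_inj.
move=> h; rewrite mem_filter.
apply/andP/mapP => [[/eqP ho /mem_histories[g lg def_h]]|].
  rewrite def_h in ho *; have [pf pfP ->] := closed_history_move_of lg ho.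
  by exists pf; rewrite ?mem_enum.
case=> -[P f]; rewrite mem_enum inE /= => /andP[partP _] ->.
rewrite opens_move_of_end //; split=> //.
by apply/mem_histories; exists (move_of (P, f)) => //; apply: move_of_legal.
Qed.
End Encoding.

Import Order.TTheory GRing.Theory Num.Theory.
Local Open Scope ring_scope.
Local Open Scope complex_scope.

(** * Expansion of the field operators *)

(** Turns the positions occurring in the exponents of q into numbers of labels. *)
Lemma sorted_ltn_count (A : seq nat) i : sorted ltn A -> i \in A ->
  index i A = count (gtn i) A /\ (size A - (index i A).+1)%N = count (ltn i) A.
Proof.
move=> srt iA; have uA := sorted_uniq ltn_trans ltnn srt.
move: srt uA; case/splitPr: iA => s1 s2.
rewrite (sorted_pairwise ltn_trans) pairwise_cat /= => /and3P[le12 _ /andP[le2 _]].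
rewrite cat_uniq /= negb_or => /and3P[_ /andP[is1 _] _].
have a1 : all (gtn i) s1.
  by move: le12; rewrite allrel_consr => /andP[].
have n1 : all (predC (ltn i)) s1.
  by apply: sub_all a1 => k /= lt_k; rewrite -leqNgt ltnW.
have n2 : all (predC (gtn i)) s2.
  by apply: sub_all le2 => k /= lt_k; rewrite -leqNgt ltnW.
rewrite index_cat (negPf is1) /= eqxx addn0 !count_cat /= !ltnn.
move: a1 le2; rewrite !all_count => /eqP-> /eqP->.
have count0 (a : pred nat) s : all (predC a) s -> count a s = 0%N.
  by rewrite all_predC has_count -eqn0Ngt => /eqP.
rewrite !count0 // size_cat /= addnS subSS addKn.
by rewrite !addn0 !add0n.
Qed.

Lemma sum_index (W : zmodType) (A : seq nat) (E : nat -> W) : uniq A ->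
  \sum_(k < size A) E k = \sum_(i <- A) E (index i A).
Proof.
move=> uA; rewrite [RHS](big_nth 0%N) big_mkord.
by apply: eq_bigr => k _; rewrite index_uniq.
Qed.

Lemma linear_sumZ (K : fieldType) (U W : lmodType K) (L : U -> W) (I : Type)
    (r : seq I) (c : I -> K) (v : I -> U) : linear L ->
  L (\sum_(i <- r) c i *: v i) = \sum_(i <- r) c i *: L (v i).
Proof.
move=> lL; elim: r => [|i r IH]; last by rewrite !big_cons lL IH.
by rewrite !big_nil; have := lL (-1) 0 0; rewrite !scaleN1r !addNr.
Qed.

Definition negative (src : option (nat * bool)) : nat :=
  if src is Some (_, c) then c else 0%N.

Definition crossings (A : seq nat) (src : option (nat * bool)) : nat :=
  if src is Some (i, _) then count (ltn i) A else 0%N.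

Definition nestings (A : seq nat) (src : option (nat * bool)) : nat :=
  if src is Some (i, c) then (c * count (gtn i) A)%N else 0%N.

Section Expansion.
Variables (R : realType) (V : lmodType R) (dot : {dot V for idfun}).
Local Notation H := (complexification V).
Local Notation F := (fock H).
Variables (bar : {linear H -> H}) (alpha q : R) (T : V -> {linear H -> H}).
Variables (y : nat -> V) (lam : nat -> R).
Local Notation ac := (alpha%:C).
Local Notation qc := (q%:C).
Local Notation field j := (field_op dot bar alpha q T (lam j) (y j)).

Definition recolor (c : bool) (v : H) : H := if c then bar v else v.

Definition relay (j : nat) (c : bool) (v : H) : H := T (y j) (recolor c v).

Definition vecs (h : seq move) : nat -> H :=
  trace (fun j => real_vec (y j)) relay h.

Definition link_factor (A : seq nat) (src : option (nat * bool)) : R[i] :=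
  ac ^+ negative src * qc ^+ (crossings A src + 2 * nestings A src).

Definition closing_factor (u : nat -> H) (j : nat) (mv : move) : R[i] :=
  if mv.2 then 1
  else if mv.1 is Some (i, c) then cdot dot (real_vec (y j)) (recolor c (u i))
  else (lam j)%:C.

Definition arrival (u : nat -> H) (j : nat) (src : option (nat * bool)) : H :=
  if src is Some (i, c) then relay j c (u i) else real_vec (y j).

Fixpoint weight (h : seq move) : R[i] :=
  if h is mv :: h' then
    weight h' * (link_factor (opens h') mv.1 * closing_factor (vecs h') (size h') mv)
  else 1.

Lemma weight_history g m : weight (history g m) =
  \prod_(j < m) (link_factor (opens (history g j)) (g j).1
                 * closing_factor (vecs (history g j)) j (g j)).
Proof.
elim: m => [|m IH]; first by rewrite big_ord0.
by rewrite big_ord_recr /= IH size_history.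
Qed.

(** The common shape of annihilation and gauge.  For the color -1 the total exponent
    (size w).-1 + k is (size w - k.+1) + 2 k, which separates the labels above i from
    twice the labels below i. *)
Lemma sum_removals (G : H -> seq H -> F) (A : seq nat) (u : nat -> H) :
  sorted ltn A ->
  let w := map u A in
  \sum_(k < size w) qc ^+ (size w - k.+1) *: G w`_k (rem_at k w)
    + (ac * qc ^+ (size w).-1) *:
        \sum_(k < size w) qc ^+ k *: G (bar w`_k) (rem_at k w)
  = \sum_(i <- A) \sum_(c <- [:: false; true])
      link_factor A (Some (i, c)) *: G (recolor c (u i)) (map u (rem i A)).
Proof.
move=> srt w; have uA := sorted_uniq ltn_trans ltnn srt.
rewrite /w size_map.
rewrite (sum_index (fun k => qc ^+ (size A - k.+1) *: G w`_k (rem_at k w))) //.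
rewrite (sum_index (fun k => qc ^+ k *: G (bar w`_k) (rem_at k w))) //.
rewrite scaler_sumr -big_split /=; apply: eq_big_seq => i iA.
rewrite big_cons big_seq1 /link_factor /= expr0 expr1 mul0n mul1n muln0 addn0 mul1r.
have [eq_lt eq_gt] := sorted_ltn_count srt iA.
have lt_i : (index i A < size A)%N by rewrite index_mem.
have -> : w`_(index i A) = u i by rewrite (nth_map 0%N) // nth_index.
have -> : rem_at (index i A) w = map u (rem i A).
  by rewrite /rem_at remE map_cat map_take map_drop.
congr (_ + _); first by rewrite eq_gt.
rewrite scalerA -mulrA -exprD -eq_gt -eq_lt; congr (_ * _ ^+ _ *: _).
by rewrite mul2n -addnn addnA; congr addn; rewrite -{1}(subnK lt_i) addnS.
Qed.

(** One field operator on one word: the sum over the moves that are possible from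
    there.  Annihilation and gauge give the moves with a source, lambda and creation
    those without. *)
Lemma field_tens (A : seq nat) (u : nat -> H) (j : nat) : sorted ltn A ->
  field j (tens (map u A)) = \sum_(mv <- moves A)
    (link_factor A mv.1 * closing_factor u j mv) *:
      tens (map u (release A mv.1) ++ (if mv.2 then [:: arrival u j mv.1] else [::])).
Proof.
move=> srt; rewrite /field_op /annihilation /creation /gauge !fock_ext_tens.
rewrite /annihilation_formula /gauge_formula.
rewrite (sum_removals (fun v w => cdot dot (real_vec (y j)) v *: tens w) u srt).
rewrite (sum_removals (fun v w => tens (rcons w (T (y j) v))) u srt).
rewrite [RHS]big_allpairs big_cons big_allpairs_dep big_cons big_seq1 /=.
have -> : link_factor A None = 1 by rewrite /link_factor expr0 mul1r expr0.
rewrite !mul1r scale1r cats0 cats1.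
have swap (a b c d : F) : a + b + c + d = d + b + (a + c).
  by rewrite [RHS]addrC addrA [a + b + c]addrAC [LHS]addrAC.
rewrite {}swap; congr (_ + _); rewrite -big_split; apply: eq_bigr => i _.
rewrite -big_split; apply: eq_bigr => c _.
by rewrite big_cons big_seq1 /= mulr1 scalerA cats0 cats1.
Qed.

Lemma field_linear j : linear (field j).
Proof.
move=> a f g; rewrite /field_op /annihilation /creation /gauge !linearP.
rewrite !scalerDr !scalerA.
have swap (a1 b1 a2 b2 a3 b3 a4 b4 : F) :
    a1 + b1 + (a2 + b2) + (a3 + b3) + (a4 + b4)
    = a1 + a2 + a3 + a4 + (b1 + b2 + b3 + b4).
  by rewrite (addrACA a1 b1) (addrACA (a1 + a2)) (addrACA (a1 + a2 + a3)).
exact: swap.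
Qed.

Lemma fields_vacuum m :
  (\big[(fun X Y => X \o Y)/id]_(k < m) (fun f : F => field (m - k.+1) f)) vacuum
  = \sum_(h <- histories m) weight h *: tens (map (vecs h) (opens h)).
Proof.
elim: m => [|m IH]; first by rewrite big_ord0 big_seq1 scale1r.
rewrite big_ord_recl; set rhs := RHS; rewrite /= subn1 /= {}IH {}/rhs.
rewrite historiesS big_allpairs_dep.
rewrite (linear_sumZ _ _ _ (field_linear m)).
have sz h : h \in histories m -> size h = m.
  by case/mem_histories=> g _ ->; rewrite size_history.
apply: eq_big_seq => h /sz <-; rewrite (field_tens _ _ (opens_sorted h)).
rewrite scaler_sumr; apply: eq_bigr => mv _; rewrite scalerA; congr (_ *: tens _).
rewrite /= map_cat; congr (_ ++ _).
  apply/esym/eq_in_map => i i_in; rewrite /vecs /= ifT //.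
  rewrite ltn_eqF // opens_lt //; move: i_in.
  by rewrite /release; case: mv.1 => // e /mem_rem.
by rewrite /vecs; case: mv => -[[i c]|] [] //=; rewrite eqxx.
Qed.

(** The hyperoctahedral group on no letters is trivial. *)
Lemma symm_vacuum : symm bar alpha q vacuum = vacuum :> F.
Proof.
rewrite /symm fock_ext_tens /symm_formula /=.
have perm1E (s : {perm letter 0}) : s = 1%g.
  by apply/permP => -[b []].
rewrite (big_pred1 (1%g : {perm letter 0})) => [|s].
  have count0 (a : pred 'I_0) w : count a w = 0%N by elim: w => [|[]].
  rewrite /len1 /len2 !count0 mulr1 scale1r /hact.
  by congr tens; apply/nilP; rewrite /nilp size_map size_enum_ord.
rewrite /= (perm1E s) eqxx inE; apply/forallP => -[b []]; done.
Qed.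

Lemma vacuum_dot_tens (w : seq H) :
  fock_dot dot bar alpha q vacuum (tens w) = (w == [::])%:R.
Proof.
have [->|w_neq] := eqVneq w [::].
  by rewrite /fock_dot symm_vacuum fock_dot0_tens big_ord0.
rewrite /fock_dot /fock_dot0 fock_ext_tens conjcK /symm fock_ext_tens.
rewrite /symm_formula /word_dot_ext raddf_sum big1 // => s _.
rewrite /= linearZ /= fock_ext_tens /word_dot /= size_map size_enum_ord eq_sym.
by rewrite size_eq0 (negPf w_neq) scaler0.
Qed.

Lemma vacuum_dot_linear :
  linear_for *%R (fock_dot dot bar alpha q (vacuum : F)).
Proof.
move=> a f g; rewrite /fock_dot /fock_dot0 !fock_ext_tens !conjcK.
by rewrite /symm /word_dot_ext !linearP.
Qed.

Lemma vacuum_state_fields m :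
  vacuum_state dot bar alpha q
    (\big[(fun X Y => X \o Y)/id]_(k < m) (fun f : F => field (m - k.+1) f))
  = \sum_(h <- histories m | opens h == [::]) weight h.
Proof.
rewrite /vacuum_state fields_vacuum.
rewrite (@linear_sumZ _ _ R[i]^o _ _ _ _ _ vacuum_dot_linear) [RHS]big_mkcond.
apply: eq_bigr => h _; rewrite vacuum_dot_tens -size_eq0 size_map size_eq0.
by case: eqP; rewrite ?scaler0 // /GRing.scale /= mulr1.
Qed.
End Expansion.

(** * Statistics and cumulants *)

Lemma card_fibers (X J : finType) (S : {set X}) (key : X -> J) :
  #|S| = (\sum_j #|[set e in S | key e == j]%SET|)%N.
Proof.
rewrite -sum1_card (partition_big key predT) //=; apply: eq_bigr => j _.
by rewrite -sum1_card; apply: eq_bigl => e; rewrite !inE.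
Qed.

Lemma count_ord n (a : pred nat) (s : seq nat) : uniq s -> all (gtn n) s ->
  count a s = #|[set k : 'I_n | (val k \in s) && a k]%SET|.
Proof.
move=> us lt_s; rewrite -size_filter cardE -(size_map val).
apply/perm_size/uniq_perm; first exact: filter_uniq.
  by rewrite (map_inj_uniq val_inj) enum_uniq.
move=> k; rewrite mem_filter; apply/andP/mapP => [[ak ks]|[l]].
  exists (Ordinal (allP lt_s _ ks)) => //.
  by rewrite mem_enum inE ks.
by rewrite mem_enum inE => /andP[ls al] ->.
Qed.

Section Statistics.
Variables (n : nat) (i0 : 'I_n).
Local Notation setT := (finset.setTfor 'I_n).
Local Notation pair := ('I_n * 'I_n)%type.
Variables (P : {set {set 'I_n}}) (f : {ffun pair -> bool}).
Hypothesis partP : finset.partition P setT.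
Local Notation g := (move_of i0 (P, f)).
Local Notation opn j := (opens (history g j)).
Implicit Types i j k l : 'I_n.

Lemma arcP i j : arc P (i, j) -> linked (finset.pblock P) i j.
Proof. by rewrite arc_linked. Qed.

Lemma arc_lt i j : arc P (i, j) -> (i < j)%N.
Proof. by move/arcP/linked_lt. Qed.

Variant source_spec j : option (nat * bool) -> Prop :=
| SourceNone of (forall i, arc P (i, j) = false) : source_spec j None
| SourceSome i of arc P (i, j) : source_spec j (Some (val i, f (i, j))).

Lemma sourceP j : source_spec j (g j).1.
Proof.
case def: (g j).1 => [e|].
  have /eqP := def; case/(source_move_ofP i0 f partP) => i ij ->.
  exact: SourceSome.
constructor=> i; apply: contraPF def => ij.
by rewrite (source_move_of i0 f partP ij).
Qed.

Lemma count_opens (a : pred nat) j :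
  count a (opn j) = #|[set k : 'I_n | (val k \in opn j) && a k]%SET|.
Proof.
apply: count_ord (opens_uniq _) _; apply/allP => k /opens_lt.
by rewrite size_history => /ltn_trans; apply.
Qed.

Lemma opens_arcP k j : reflect
  ((k < j)%N /\ exists2 l : 'I_n, (j <= l)%N & arc P (k, l)) (val k \in opn j).
Proof.
rewrite mem_opens_move_of //; last exact: ltnW.
apply: (iffP andP) => -[lt_kj].
  by case/existsP=> l /andP[]; split=> //; exists l.
by case=> l le_jl kl; split=> //; apply/existsP; exists l; rewrite le_jl.
Qed.

Lemma Narc_sum : Narc P f = (\sum_(j < n) negative (g j).1)%N.
Proof.
rewrite /Narc (card_fibers _ (fun e => e.2)); apply: eq_bigr => j _.
case: sourceP => [no|i ij] /=.
  apply/eqP; rewrite cards_eq0; apply/eqP/finset.setP => -[k l]; rewrite !inE /=.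
  by apply/negP => /andP[/andP[kl _] /eqP eq_l]; rewrite eq_l no in kl.
rewrite -[RHS]muln1 -(cards1 (i, j)); case fij: (f (i, j)); last first.
  rewrite mul0n; apply/eqP; rewrite cards_eq0; apply/eqP/finset.setP => -[k l].
  rewrite !inE /=; apply/negP => /andP[/andP[kl fkl] /eqP eq_l].
  by rewrite eq_l in kl fkl; rewrite (linked_inj (arcP kl) (arcP ij)) fij in fkl.
rewrite mul1n; congr #|pred_of_set _|; apply/finset.setP => -[k l]; rewrite !inE /=.
apply/andP/eqP => [[/andP[kl _] /eqP eq_l]|[-> ->]]; last by rewrite ij fij.
by rewrite eq_l in kl *; rewrite (linked_inj (arcP kl) (arcP ij)).
Qed.

(** A crossing is counted at the right end j of its left arc (i, j).  The left end of
    the other arc determines it, and runs through the open elements above i. *)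
Lemma rc_sum : rc P = (\sum_(j < n) crossings (opn j) (g j).1)%N.
Proof.
rewrite /rc (card_fibers _ (fun ee => ee.1.2)); apply: eq_bigr => j _.
case: sourceP => [no|i ij] /=.
  apply/eqP; rewrite cards_eq0; apply/eqP/finset.setP => -[[k l] e].
  by rewrite !inE /=; apply/negP => /andP[/andP[kl _] /eqP eq_l]; rewrite eq_l no in kl.
rewrite count_opens.
rewrite -(@card_in_imset _ _ (fun ee : pair * pair => ee.2.1)); last first.
  move=> [[k l] [k' l']] [[m p] [m' p']]; rewrite !inE /=.
  move=> /andP[/and5P[kl kl' _ _ _] /eqP eq_l] /andP[/and5P[mp mp' _ _ _] /eqP eq_p].
  move=> eq_k; rewrite eq_l in kl *; rewrite eq_p in mp *; rewrite -eq_k in mp' *.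
  by rewrite (linked_inj (arcP kl) (arcP mp)) (linked_fun (arcP kl') (arcP mp')).
congr #|pred_of_set _|; apply/finset.setP => k; rewrite [RHS]inE.
apply/imsetP/andP => [[[[m p] [m' p']]]|[/opens_arcP[lt_kj [l le_jl kl]] /= lt_ik]].
  rewrite !inE /= => /andP[/and5P[mp mp' _ lt_m /andP[lt_mp lt_p]] /eqP eq_p] ->.
  rewrite eq_p in mp lt_mp lt_p; split; last first.
    by rewrite -(linked_inj (arcP mp) (arcP ij)).
  by apply/opens_arcP; split=> //; exists p' => //; apply: ltnW.
exists ((i, j), (k, l)) => //; rewrite !inE /= ij kl lt_ik lt_kj eqxx !andbT /=.
have /linkedP[_ _ no] := arcP ij; apply/andP; split.
  by apply/eqP => /esym/no/(_ lt_ik); rewrite leqNgt lt_kj.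
rewrite ltn_neqAle le_jl andbT; apply/eqP => /val_inj eq_jl.
by rewrite -eq_jl in kl; rewrite (linked_inj (arcP kl) (arcP ij)) ltnn in lt_ik.
Qed.

(** A nesting is counted at the right end j of its inner arc (i, j).  The left end of
    the outer arc determines it, and runs through the open elements below i. *)
Lemma rnarc_sum : rnarc P f = (\sum_(j < n) nestings (opn j) (g j).1)%N.
Proof.
rewrite /rnarc (card_fibers _ (fun ee => ee.2.2)); apply: eq_bigr => j _.
case: sourceP => [no|i ij] /=.
  apply/eqP; rewrite cards_eq0; apply/eqP/finset.setP => -[e [k l]].
  rewrite !inE /=; apply/negP => /andP[/and4P[_ kl _ _] /eqP eq_l].
  by rewrite eq_l no in kl.
case fij: (f (i, j)); last first.
  rewrite mul0n; apply/eqP; rewrite cards_eq0; apply/eqP/finset.setP => -[e [k l]].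
  rewrite !inE /=; apply/negP => /andP[/and5P[_ kl _ fkl _] /eqP eq_l].
  by rewrite eq_l in kl fkl; rewrite (linked_inj (arcP kl) (arcP ij)) fij in fkl.
rewrite mul1n count_opens.
rewrite -(@card_in_imset _ _ (fun ee : pair * pair => ee.1.1)); last first.
  move=> [[k' l'] [k l]] [[m' p'] [m p]]; rewrite !inE /=.
  move=> /andP[/and5P[kl' kl _ _ _] /eqP eq_l] /andP[/and5P[mp' mp _ _ _] /eqP eq_p].
  move=> eq_k; rewrite eq_l in kl *; rewrite eq_p in mp *; rewrite -eq_k in mp' *.
  by rewrite (linked_inj (arcP kl) (arcP mp)) (linked_fun (arcP kl') (arcP mp')).
congr #|pred_of_set _|; apply/finset.setP => k; rewrite [RHS]inE.
apply/imsetP/andP => [[[[m' p'] [m p]]]|[/opens_arcP[lt_kj [l le_jl kl]] /= lt_ki]].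
  rewrite !inE /= => /andP[/and5P[mp' mp _ _ /and3P[lt_m lt_mp lt_p]] /eqP eq_p] ->.
  rewrite eq_p in mp lt_mp lt_p; split; last first.
    by rewrite -(linked_inj (arcP mp) (arcP ij)).
  apply/opens_arcP; split; first exact: ltn_trans lt_m lt_mp.
  by exists p' => //; apply: ltnW.
exists ((k, l), (i, j)) => //.
rewrite !inE /= ij kl fij lt_ki (arc_lt ij) eqxx !andbT /=.
have /linkedP[_ _ no] := arcP kl; apply/andP; split.
  apply/eqP => /esym/no/(_ lt_ki); rewrite leqNgt.
  by rewrite (leq_trans (arc_lt ij) le_jl).
rewrite ltn_neqAle le_jl andbT; apply/eqP => /val_inj eq_jl.
by rewrite -eq_jl in kl; rewrite (linked_inj (arcP kl) (arcP ij)) ltnn in lt_ki.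
Qed.

Section Weight.
Variables (R : realType) (V : lmodType R) (dot : {dot V for idfun}).
Local Notation H := (complexification V).
Variables (bar : {linear H -> H}) (alpha q : R) (T : V -> {linear H -> H}).
Variables (x : 'I_n -> V) (lambda : 'I_n -> R).
Local Notation y := (fun j : nat => x (insubd i0 j)).
Local Notation lam := (fun j : nat => lambda (insubd i0 j)).
Local Notation vec := (vecs bar T y (history g n)).
Local Notation fac := (fun j : 'I_n => closing_factor dot bar y lam vec j (g j)).

(** The vector of the source is settled once the source has been processed, so it can
    be read off the complete history. *)
Lemma closing_prefix j :
  closing_factor dot bar y lam (vecs bar T y (history g j)) j (g j) = fac j.
Proof.
rewrite /closing_factor; case: ifP => // _; case: sourceP => // i ij.
congr (cdot _ _ (recolor _ _ _)); rewrite /vecs trace_history ?arc_lt //.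
exact: esym (trace_history _ _ _ (ltn_ord i)).
Qed.

Lemma vec_first j : (forall i, arc P (i, j) = false) -> vec j = real_vec (x j).
Proof.
move=> no; rewrite /vecs.
rewrite (trace_last _ _ (@move_of_legal n i0 P f partP n (leqnn n))) //.
by case: sourceP => [_|i]; rewrite ?valKd ?no.
Qed.

Lemma vec_arc i j : arc P (i, j) ->
  vec j = T (x j) (recolor bar (f (i, j)) (vec i)).
Proof.
move=> ij; rewrite [LHS](trace_last _ _ (@move_of_legal n i0 P f partP n (leqnn n))) //.
by rewrite (source_move_of i0 f partP ij) /relay valKd.
Qed.

Lemma fac_stays i j : arc P (i, j) -> fac i = 1.
Proof.
move=> ij; rewrite /closing_factor stays_move_of.
by have -> : [exists l, arc P (i, l)] by apply/existsP; exists j.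
Qed.

Lemma fac_closes j : (forall l, arc P (j, l) = false) ->
  fac j = if (g j).1 is Some (i, c)
          then cdot dot (real_vec (x j)) (recolor bar c (vec i))
          else (lambda j)%:C.
Proof.
move=> no; rewrite /closing_factor stays_move_of valKd.
have -> // : [exists l, arc P (j, l)] = false.
by apply/existsP => -[l]; rewrite no.
Qed.

Section Block.
Variable B : {set 'I_n}.
Hypothesis BP : B \in P.

Lemma enum_block s1 i s2 : enum B = s1 ++ i :: s2 ->
  [/\ finset.pblock P i = B, all (fun k : 'I_n => (k < i)%N) s1
    & all (fun k : 'I_n => (i < k)%N) s2].
Proof.
move=> def_B; have /and3P[_ tiP _] := partP.
have srt : sorted (fun k l : 'I_n => (k < l)%N) (enum B).
  rewrite {1}/enum_mem -enumT; apply: sorted_filter.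
    by move=> k l m; apply: ltn_trans.
  have : sorted ltn (map val (enum 'I_n)) by rewrite val_enum_ord iota_ltn_sorted.
  by rewrite sorted_map.
move: srt; rewrite def_B sorted_pairwise; last by move=> k l m; apply: ltn_trans.
rewrite pairwise_cat /= allrel_consr => /and3P[/andP[-> _] _ /andP[-> _]].
split=> //; apply: def_pblock tiP BP _.
by rewrite -mem_enum def_B mem_cat mem_head orbT.
Qed.

Lemma mem_enum_block s1 i s2 k : enum B = s1 ++ i :: s2 ->
  finset.pblock P k = finset.pblock P i -> k \in s1 ++ i :: s2.
Proof.
move=> def_B; have [-> _ _] := enum_block def_B => pk.
have /and3P[/eqP cov _ _] := partP.
by rewrite -def_B mem_enum -pk mem_pblock cov finset.in_setT.
Qed.

(** The enumeration of a block is increasing, so nothing of the block lies between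
    two consecutive entries. *)
Lemma enum_block_arc s1 i j s2 : enum B = s1 ++ i :: j :: s2 -> arc P (i, j).
Proof.
move=> def_B; have [pi lt1 /= /andP[lt_ij lt2]] := enum_block def_B.
have [pj _ lt2'] :=
  @enum_block (rcons s1 i) j s2 (etrans def_B (esym (cat_rcons _ _ _))).
rewrite arc_linked //; apply/linkedP; split=> [|//|k]; first by rewrite pi pj.
move/(mem_enum_block def_B); rewrite mem_cat !inE.
move=> /or4P[k1|/eqP->|/eqP->|k2] lt_ik //.
- by have := ltn_trans (allP lt1 _ k1) lt_ik; rewrite ltnn.
- by rewrite ltnn in lt_ik.
exact: ltnW (allP lt2' _ k2).
Qed.

Lemma enum_block_last s j l : enum B = rcons s j -> arc P (j, l) = false.
Proof.
rewrite -cats1 => def_B; have [pj lt1 _] := enum_block def_B.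
apply/negbTE/negP => /arcP/linkedP[eq_p lt_jl _].
have := mem_enum_block def_B (esym eq_p); rewrite mem_cat inE.
case/orP=> [/(allP lt1)|/eqP eq_l]; last by rewrite eq_l ltnn in lt_jl.
by rewrite ltnNge ltnW.
Qed.

Lemma enum_block_first i s k : enum B = i :: s -> arc P (k, i) = false.
Proof.
move=> def_B; have [pi _ lt2] := @enum_block [::] i s def_B.
apply/negbTE/negP => /arcP/linkedP[eq_p lt_ki _].
have := @mem_enum_block [::] i s k def_B eq_p; rewrite inE.
case/predU1P=> [eq_k|/(allP lt2)]; first by rewrite eq_k ltnn in lt_ki.
by rewrite ltnNge ltnW.
Qed.

(** Along a block only the greatest element contributes a factor other than 1, and
    the vector that it is paired with is the one computed by the walk. *)
Lemma block_walk_prod s s1 i j : enum B = s1 ++ i :: j :: s ->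
  block_walk dot bar T x f (vec i) i j s = \prod_(k <- j :: s) fac k.
Proof.
elim: s s1 i j => [|k s IH] s1 i j def_B; have ij := enum_block_arc def_B.
  rewrite big_seq1 fac_closes => [|l].
    by rewrite (source_move_of i0 f partP ij).
  by apply: (@enum_block_last (rcons s1 i)); rewrite def_B -cats1 cat_rcons.
have def_B' : enum B = rcons s1 i ++ j :: k :: s by rewrite cat_rcons.
rewrite big_cons (fac_stays (enum_block_arc def_B')) mul1r -(IH _ _ _ def_B').
by rewrite (vec_arc ij).
Qed.

Lemma block_cumulant_prod :
  block_cumulant dot bar T x lambda f B = \prod_(j in B) fac j.
Proof.
rewrite -big_enum /block_cumulant.
case def_B: (enum B) => [|i [|j s]]; first by rewrite big_nil.
  rewrite big_seq1 fac_closes => [|l]; last exact: (@enum_block_last [::]).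
  by case: sourceP => // k; rewrite (enum_block_first k def_B).
rewrite big_cons (fac_stays (@enum_block_arc [::] i j s def_B)) /= mul1r.
rewrite -(@block_walk_prod s [::] i j def_B) vec_first // => k.
exact: enum_block_first def_B.
Qed.
End Block.

Lemma weight_move_of :
  weight dot bar alpha q T y lam (history g n)
  = alpha%:C ^+ Narc P f * q%:C ^+ (rc P + 2 * rnarc P f)
    * cumulant dot bar T x lambda f P.
Proof.
rewrite weight_history big_split /=; congr (_ * _).
  rewrite /link_factor big_split /= !prodrXr -Narc_sum; congr (_ * _ ^+ _).
  by rewrite rc_sum rnarc_sum big_distrr -big_split.
rewrite /cumulant (eq_bigr _ (fun B => @block_cumulant_prod B)).
rewrite -(set_partition_big _ partP); apply: eq_big => [j|j _].
  by rewrite finset.in_setT.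
exact: closing_prefix.
Qed.
End Weight.
End Statistics.

Theorem theorem2 (R : realType)
    (HR : completeNormedModType R) (dot : {dot HR for idfun})
    (dot_norm : forall u : HR, dot u u = `|u| ^+ 2)
    (HR_separable : exists A : set HR, countable A /\ dense A)
    (bar : {linear complexification HR -> complexification HR})
    (bar_bounded : bounded_operator dot bar)
    (bar_selfadjoint : selfadjoint dot bar)
    (bar_involutive : forall u, bar (bar u) = u)
    (T : HR -> {linear complexification HR -> complexification HR})
    (T_bounded : forall u, bounded_operator dot (T u))
    (T_selfadjoint : forall u, selfadjoint dot (T u))
    (alpha q : R) (alpha_range : -1 < alpha < 1) (q_range : -1 < q < 1)
    (n : nat) (n_gt0 : (0 < n)%N) (x : 'I_n -> HR) (lambda : 'I_n -> R) :
  vacuum_state dot bar alpha q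
    (\big[(fun X Y => X \o Y)/id]_(i < n)
       field_op dot bar alpha q T (lambda (rev_ord i)) (x (rev_ord i)))
  = \sum_(pf in partitionB n)
      alpha%:C ^+ Narc pf.1 pf.2
      * q%:C ^+ (rc pf.1 + 2 * rnarc pf.1 pf.2)
      * cumulant dot bar T x lambda pf.2 pf.1.
Proof.
pose i0 := Ordinal n_gt0.
pose y j := x (insubd i0 j); pose lam j := lambda (insubd i0 j).
transitivity (vacuum_state dot bar alpha q
  (\big[(fun X Y => X \o Y)/id]_(k < n)
     (fun f => field_op dot bar alpha q T (lam (n - k.+1)%N) (y (n - k.+1)%N) f))).
  congr vacuum_state; apply: eq_bigr => k _.
  by rewrite /lam /y -[(n - k.+1)%N]/(val (rev_ord k)) valKd.
rewrite vacuum_state_fields -big_filter (perm_big _ (perm_histories i0)) big_map.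
rewrite big_enum; apply: eq_bigr => -[P f]; rewrite inE => /andP[partP _].
exact: weight_move_of.
Qed.
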